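(* Let $k_0>0$ and let $x_1,x_2,x_3,x_4\in\mathbb{R}^3$ be four non-coplanar points (sensors). Consider a single point source in $\mathbb{R}^3$ with location $z_1\in\mathbb{R}^3\setminus\{x_1,x_2,x_3,x_4\}$ and scattering strength $\tau_1\in\mathbb{C}\setminus\{0\}$. Then both $z_1$ and $\tau_1$ are uniquely determined by the scattered fields $u^s(x,k)$ for $x\in\{x_1,x_2,x_3,x_4\}$ and $k\in\{k_0,2k_0,4k_0\}$. That is: if $(z_1,\tau_1)$ and $(z_1',\tau_1')$ are two such sources whose scattered fields coincide for all $x\in\{x_1,x_2,x_3,x_4\}$ and all $k\in\{k_0,2k_0,4k_0\}$, then $z_1=z_1'$ and $\tau_1=\tau_1'$.
   Context: For wave number $k>0$, the scattered field (for the biharmonic wave equation $\Delta^2u^s-k^4u^s=\tau_1\delta_{z_1}$ in $\mathbb{R}^3$, with $\delta_{z_1}$ the Dirac measure at $z_1$, under the radiation condition $\partial_r w-ikw=o(r^{-1})$ as $r=|x|\to\infty$ for $w=u^s,\Delta u^s$) of a single point source at $z_1\in\mathbb{R}^3$ with scattering strength $\tau_1$ is $$u^s(x,k)=\frac{\tau_1}{8\pi k^2|x-z_1|}\left(e^{ik|x-z_1|}-e^{-k|x-z_1|}\right),\qquad x\in\mathbb{R}^3\setminus\{z_1\}.$$ *)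

(* Defs.v *)
From HB Require Import structures.
From mathcomp Require Import all_boot all_order all_algebra.
From mathcomp Require Import complex.
From mathcomp Require Import reals sequences exp trigo.

Set Implicit Arguments.
Unset Strict Implicit.
Unset Printing Implicit Defensive.

Import Order.TTheory GRing.Theory Num.Theory.
Local Open Scope ring_scope.
Local Open Scope complex_scope.

Section Biharmonic.
Context {R : realType}.

Definition dot (x y : 'rV[R]_3) : R := \sum_(i < 3) x 0 i * y 0 i.

(* [`|x|] on ['rV[R]_3] is the sup norm in MathComp-Analysis, hence a separate
   Euclidean norm. *)
Definition enorm (x : 'rV[R]_3) : R := Num.sqrt (dot x x).

Definition coplanar (p : 'I_4 -> 'rV[R]_3) : Prop :=
  exists (n : 'rV[R]_3) (c : R), n != 0 /\ forall j, dot n (p j) = c.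

Definition cexp (z : R[i]) : R[i] :=
  let: a +i* b := z in (expR a)%:C * (cos b +i* sin b).

(* Only meaningful for [x != z]: at [x = z] the prefactor is [tau / 0 = 0]. *)
Definition scattered_field (z : 'rV[R]_3) (tau : R[i]) (x : 'rV[R]_3) (k : R)
    : R[i] :=
  let r := enorm (x - z) in
  tau / (8 * pi * k ^+ 2 * r)%:C * (cexp ('i%C * (k * r)%:C) - cexp (- (k * r))%:C).

End Biharmonic.

(* Main.v *)
(** With [p = e^{ikr}] and [q = e^{-kr}], doubling the wave number multiplies
    [p - q] by [p + q]. The data at [k0, 2 k0, 4 k0] therefore determine
    [p + q] and [p^2 + q^2] at [k = k0], hence [p q], whose modulus is
    [e^{- k0 r}]: each distance [r = |x_j - z|] is determined, and with it the
    strength. Two distinct points equidistant from every [x_j] would place all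
    the [x_j] in their bisecting plane. *)
Require Import Defs.
From mathcomp Require Import all_boot all_order all_algebra.
From mathcomp Require Import complex.
From mathcomp Require Import reals.
From mathcomp Require Import sequences exp trigo ring lra.

Import Order.TTheory GRing.Theory Num.Theory.
Local Open Scope ring_scope.
Local Open Scope complex_scope.

Lemma dotBB (R : realType) (x z : 'rV[R]_3) :
  dot (x - z) (x - z) = dot x x - 2 * dot z x + dot z z.
Proof. by rewrite /dot !big_ord_recl !big_ord0 !mxE; ring. Qed.

Lemma dotBl (R : realType) (x y z : 'rV[R]_3) :
  dot (x - y) z = dot x z - dot y z.
Proof. by rewrite /dot !big_ord_recl !big_ord0 !mxE; ring. Qed.

Lemma dot_ge0 (R : realType) (x : 'rV[R]_3) : 0 <= dot x x.
Proof. by apply: sumr_ge0 => i _; rewrite -expr2 sqr_ge0. Qed.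

Lemma dot_eq0 (R : realType) (x : 'rV[R]_3) : (dot x x == 0) = (x == 0).
Proof.
apply/idP/eqP => [|->]; last by rewrite /dot big1 // => i _; rewrite mxE mul0r.
rewrite /dot psumr_eq0 => [/allP x0|i _]; last by rewrite -expr2 sqr_ge0.
apply/rowP => i; rewrite mxE; apply/eqP.
by have := x0 i (mem_index_enum _); rewrite -expr2 sqrf_eq0.
Qed.

Lemma enorm_gt0 (R : realType) (x : 'rV[R]_3) : x != 0 -> 0 < enorm x.
Proof. by move=> x0; rewrite sqrtr_gt0 lt_neqAle eq_sym dot_eq0 x0 dot_ge0. Qed.

Lemma equidistant_eq (R : realType) (x : 'I_4 -> 'rV[R]_3) (z z' : 'rV[R]_3) :
  ~ coplanar x -> (forall j, enorm (x j - z) = enorm (x j - z')) -> z = z'.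
Proof.
move=> ncop eqd; apply/eqP/negPn/negP => zz'; apply: ncop.
(* The bisecting plane: equating the squared distances to [z] and [z'] cancels [dot (x j) (x j)] and
   leaves a linear equation in [x j]. *)
exists (z - z'), ((dot z z - dot z' z') / 2); split; first by rewrite subr_eq0.
move=> j; have := eqd j; rewrite /enorm => /(congr1 (fun t => t ^+ 2)).
rewrite !sqr_sqrtr ?dot_ge0 // !dotBB dotBl => e.
by lra.
Qed.

Section Fields.
Variable R : realType.
Implicit Types (t : R) (c : R[i]).

Definition cis t : R[i] := cos t +i* sin t.
Definition decay t : R[i] := (expR (- t))%:C.

(** Splits off the prefactor common to all sources, so that the remaining amplitude [tau / r] does
    not depend on [k]. *)
Lemma scattered_fieldE (z x : 'rV[R]_3) (tau : R[i]) (k : R) :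
  scattered_field z tau x k =
  (8 * pi * k ^+ 2)%:C^-1 * (tau / (enorm (x - z))%:C
    * (cis (k * enorm (x - z)) - decay (k * enorm (x - z)))).
Proof.
rewrite /scattered_field /cis /decay [RHS]mulrA [_^-1 * _]mulrCA -invfM -rmorphM.
congr (_ * (_ - _)) => /=.
  by rewrite !(mul0r, mul1r, mulr0, subr0, addr0, add0r) oppr0 expR0 mul1r.
by rewrite cos0 sin0 mulr1.
Qed.

Lemma cis_double t : cis (2 * t) = cis t ^+ 2.
Proof.
by rewrite mulr_natl mulr2n /cis cosD sinD expr2; congr (_ +i* _); ring.
Qed.

Lemma decay_double t : decay (2 * t) = decay t ^+ 2.
Proof. by rewrite /decay -mulrN expRM_natl rmorphXn. Qed.

Lemma norm_cis t : `|cis t| = 1.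
Proof. by rewrite normc_def /= cos2Dsin2 sqrtr1. Qed.

Lemma norm_decay t : `|decay t| = decay t.
Proof. by rewrite ger0_norm // lecR expR_ge0. Qed.

Lemma norm_decay_lt1 t : 0 < t -> `|decay t| < 1.
Proof. by move=> t0; rewrite norm_decay ltcR -expR0 ltr_expR oppr_lt0. Qed.

(** The two terms have different moduli, 1 and [expR (- t) < 1]. The same holds for the sum below;
    both serve as divisors in [phase_inj]. *)
Lemma cis_sub_decay_neq0 t : 0 < t -> cis t - decay t != 0.
Proof.
move=> t0; rewrite subr_eq0; apply/eqP => e.
by have := norm_decay_lt1 _ t0; rewrite -e norm_cis ltxx.
Qed.

Lemma cis_add_decay_neq0 t : 0 < t -> cis t + decay t != 0.
Proof.
move=> t0; rewrite addr_eq0; apply/eqP => e.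
by have := norm_decay_lt1 _ t0; rewrite -normrN -e norm_cis ltxx.
Qed.

(** The amplitudes may differ, since [tau / r] involves the unknown distance; dividing each equation
    by the preceding one eliminates them. *)
Lemma phase_inj (a b : R) (c c' : R[i]) : 0 < a -> c != 0 ->
  c * (cis a - decay a) = c' * (cis b - decay b) ->
  c * (cis (2 * a) - decay (2 * a)) = c' * (cis (2 * b) - decay (2 * b)) ->
  c * (cis (4 * a) - decay (4 * a)) = c' * (cis (4 * b) - decay (4 * b)) ->
  a = b.
Proof.
have four (t : R) : 4 * t = 2 * (2 * t) by ring.
move=> a0 c0; rewrite !four !(cis_double, decay_double) => e1 e2 e4.
have p0 := cis_sub_decay_neq0 _ a0; have q0 := cis_add_decay_neq0 _ a0.
have s1 : cis a + decay a = cis b + decay b.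
  (* Factor the differences of squares in [e2] and cancel the common value given by [e1]. *)
  apply: (mulfI (mulf_neq0 c0 p0)).
  by rewrite {2}e1 -!mulrA -!subr_sqr.
have s2 : cis a ^+ 2 + decay a ^+ 2 = cis b ^+ 2 + decay b ^+ 2.
  have n2 : cis a ^+ 2 - decay a ^+ 2 != 0 by rewrite subr_sqr mulf_neq0.
  apply: (mulfI (mulf_neq0 c0 n2)).
  by rewrite {2}e2 -!mulrA -!subr_sqr.
have pq : cis a * decay a = cis b * decay b.
  have two0 : (2 : R[i]) != 0 by rewrite pnatr_eq0.
  apply: (mulfI two0).
  have h (u v : R[i]) : 2 * (u * v) = (u + v) ^+ 2 - (u ^+ 2 + v ^+ 2) by ring.
  by rewrite !h s1 s2.
(* Moduli discard the phase, which fixes [a] only modulo 2 pi, and keep the injective real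
   exponential. *)
move/(congr1 Num.norm): pq; rewrite !normrM !norm_cis !mul1r !norm_decay.
by move=> /complexI /expR_inj /oppr_inj.
Qed.

End Fields.

Theorem theorem3p5 (R : realType) (k0 : R) (x : 'I_4 -> 'rV[R]_3)
    (z z' : 'rV[R]_3) (tau tau' : R[i]) :
  0 < k0 ->
  ~ coplanar x ->
  (forall j, z != x j) -> tau != 0 ->
  (forall j, z' != x j) -> tau' != 0 ->
  (forall (j : 'I_4) (k : R), k \in [:: k0; 2 * k0; 4 * k0] ->
     scattered_field z tau (x j) k = scattered_field z' tau' (x j) k) ->
  z = z' /\ tau = tau'.
Proof.
move=> k00 ncop zx tau0 z'x tau'0 E.
have r0 j : 0 < enorm (x j - z) by rewrite enorm_gt0 // subr_eq0 eq_sym.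
have amp (j : 'I_4) (k : R) : 0 < k -> k \in [:: k0; 2 * k0; 4 * k0] ->
    tau / (enorm (x j - z))%:C
      * (cis _ (k * enorm (x j - z)) - decay _ (k * enorm (x j - z))) =
    tau' / (enorm (x j - z'))%:C
      * (cis _ (k * enorm (x j - z')) - decay _ (k * enorm (x j - z'))).
  move=> kgt0 /(E j); rewrite !scattered_fieldE; apply: mulfI.
  by rewrite invr_eq0 fmorph_eq0 gt_eqF // !mulr_gt0 ?exprn_gt0 ?pi_gt0.
have eqd j : enorm (x j - z) = enorm (x j - z').
  (* Compare [k0 * r] rather than [r]: the three wave numbers then give the arguments [a], [2 * a],
     [4 * a]. *)
  apply: (mulfI (lt0r_neq0 k00)).
  apply: (@phase_inj R _ _ (tau / (enorm (x j - z))%:C)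
                           (tau' / (enorm (x j - z'))%:C)).
  - by rewrite mulr_gt0.
  - by rewrite mulf_neq0 // invr_eq0 fmorph_eq0 gt_eqF.
  - by apply: amp; rewrite ?mem_head.
  - by rewrite !mulrA; apply: amp; rewrite ?mulr_gt0 // !inE eqxx orbT.
  - by rewrite !mulrA; apply: amp; rewrite ?mulr_gt0 // !inE eqxx !orbT.
have zz' : z = z' by apply: equidistant_eq ncop eqd.
(* With the locations equal, one sensor and one wave number suffice: both sides carry the same
   nonzero factors besides the strength. *)
split=> //; have := amp ord0 k0 k00 (mem_head _ _); rewrite -zz'.
move=> /(mulIf (cis_sub_decay_neq0 _ _ (mulr_gt0 k00 (r0 ord0)))).
by apply: mulIf; rewrite invr_eq0 fmorph_eq0 gt_eqF.
Qed.
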